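(* Let $n\ge2$, $\psi\in A$ and $\Omega=\Omega(\psi)$. There is a Riemannian metric $\beta$ on $\Omega$ that is preserved by $G(\psi)$ and by the radial flow $\Phi^\psi$, and $(\Omega,\beta)$ is isometric to $\mathbb R^{n-1}\times[0,\infty)$ with the usual Euclidean metric. The restriction of $\beta$ to $\partial\Omega$ is conformally equivalent to the second fundamental form of $\partial\Omega$ in the affine patch $\mathbb A(\Omega)=\mathbb R^n$.
   Context: $A=\{\psi\in\mathrm{Hom}(\mathbb R^n,\mathbb R): \psi_i:=\psi(e_i),\ \psi_1\ge\cdots\ge\psi_n\ge 0\}$. For $\psi\in A$ the type is $\mathbf t=|\{i:\psi_i>0\}|$; $V_\psi=\mathbb R_+^{\mathbf t}\times\mathbb R^{n-\mathbf t}$ with $\mathbb R_+=(0,\infty)$; $h_\psi:V_\psi\to\mathbb R$ is $$h_\psi(x)=-x_{\mathbf t+1}-\sum_{i=1}^{\mathbf t}\psi_i\log x_i+\tfrac12\sum_{i=\mathbf t+2}^n x_i^2\ (\mathbf t<n),\qquad h_\psi(x)=-\Big(\sum_{i=1}^n\psi_i\Big)^{-1}\sum_{i=1}^n\psi_i\log x_i\ (\mathbf t=n).$$ $\Omega(\psi)=h_\psi^{-1}((-\infty,0])\subset\mathbb R^n\subset\mathbb{RP}^n$ via $x\mapsto[x_1:\cdots:x_n:1]$; $\partial\Omega(\psi)=h_\psi^{-1}(0)$. $G(\psi)\subset\mathrm{PGL}(n+1,\mathbb R)$ is the subgroup preserving each level set of $h_\psi$. $\mathbb A(\Omega)=\mathbb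 R^n$ is the unique affine patch of $\mathbb{RP}^n$ containing $\Omega$ as a closed subset. The radial flow $\Phi^\psi=(\Phi_t)$ acts on $V_\psi$ by $\Phi_t(x)=x-t\,e_{\mathbf t+1}$ if $\mathbf t<n$ and $\Phi_t(x)=e^{-t}x$ if $\mathbf t=n$. It maps $\Omega$ into itself for $t\le0$; a metric on $\Omega$ is preserved by the flow if $\Phi_t^*\beta=\beta$ wherever defined. For a transversally oriented smooth hypersurface $S\subset\mathbb R^n$ with unit normal $n_q$, the second fundamental form at $q$ is the quadratic form $\mathrm{II}_q(\gamma'(0))=\langle\gamma''(0),n_q\rangle$ for smooth curves $\gamma$ in $S$ with $\gamma(0)=q$; for a convex hypersurface $n_q$ points to the convex side. Conformally equivalent means equal up to multiplication by a positive function. *)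

(* Defs.v *)
From HB Require Import structures.
From mathcomp Require Import all_boot all_order all_algebra.
From mathcomp Require Import all_classical all_reals all_analysis.

Set Implicit Arguments.
Unset Strict Implicit.
Unset Printing Implicit Defensive.

Import Order.TTheory GRing.Theory Num.Theory.
Import numFieldNormedType.Exports.

Local Open Scope classical_set_scope.
Local Open Scope ring_scope.

(* Vectors of R^n are row vectors; the coordinates x_1, ..., x_n of the
   mathematics are x 0 i with i : 'I_n counted from 0, so that x_(t+1) is the
   coordinate of index t. *)

Section Smooth.
Context {R : realType}.

(* C^oo on an open set U: all iterated directional derivatives, of every order
   including 0, are (Frechet) differentiable at every point of U. *)
Definition smooth_on {V W : normedModType R} (U : set V) (f : V -> W) : Prop :=
  forall (s : seq V) (x : V), U x ->
    differentiable (foldr (fun v g => 'D_v g) f s) x.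

Definition smooth_extension {V W : normedModType R} (S : set V) (f : V -> W)
    (x : V) (U : set V) (F : V -> W) : Prop :=
  [/\ open U, U x, smooth_on U F & forall y, U y -> S y -> F y = f y].

(* Smoothness on an arbitrary subset, e.g. on a codimension 0 submanifold with
   boundary; the values of f outside S are irrelevant. *)
Definition smooth_within {V W : normedModType R} (S : set V) (f : V -> W) :
    Prop :=
  forall x, S x -> exists U F, smooth_extension S f x U F.

End Smooth.

Section Riemannian.
Context {R : realType} {n : nat}.

(* A field of bilinear forms on R^n is given by its Gram matrices in the
   standard frame: beta x stands for (u, v) |-> u *m beta x *m v^T. *)
Definition qform (B : 'M[R]_n) (u : 'rV[R]_n) : R := (u *m B *m u^T) 0 0.

(* S is meant to be a codimension 0 submanifold with boundary of R^n, so that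
   its tangent space at every point, boundary included, is R^n. *)
Definition riemannian_metric (S : set 'rV[R]_n) (beta : 'rV[R]_n -> 'M[R]_n) :
    Prop :=
  smooth_within S beta /\
  forall x, S x ->
    (beta x)^T = beta x /\ forall u, u != 0 -> 0 < qform (beta x) u.

(* 'J F x is the matrix of 'd F x acting on row vectors by right
   multiplication. *)
Definition pullback (F : 'rV[R]_n -> 'rV[R]_n) (beta : 'rV[R]_n -> 'M[R]_n)
    (x : 'rV[R]_n) : 'M[R]_n :=
  'J F x *m beta (F x) *m ('J F x)^T.

(* Riemannian isometry: a diffeomorphism f from S onto T, with inverse g, such
   that f^* gamma = beta. At a boundary point the differential of f is that of
   a local smooth extension F; it does not depend on F when S is contained in
   the closure of its interior. *)
Definition isometric (S : set 'rV[R]_n) (beta : 'rV[R]_n -> 'M[R]_n)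
    (T : set 'rV[R]_n) (gamma : 'rV[R]_n -> 'M[R]_n) : Prop :=
  exists f g : 'rV[R]_n -> 'rV[R]_n,
  [/\ (forall x, S x -> T (f x) /\ g (f x) = x),
      (forall y, T y -> S (g y) /\ f (g y) = y),
      smooth_within T g &
      forall x, S x -> exists U F,
        smooth_extension S f x U F /\ pullback F gamma x = beta x].

Definition euclidean (x : 'rV[R]_n) : 'M[R]_n := 1%:M.

(* R^(n-1) x [0, oo), as the set of points of R^n whose last coordinate is
   nonnegative. *)
Definition half_space : set 'rV[R]_n :=
  [set y | forall i : 'I_n, val i = n.-1 -> 0 <= y 0 i].

End Riemannian.

Section Hypersurface.
Context {R : realType} {n : nat}.

Definition dotv (u v : 'rV[R]_n) : R := \sum_i u 0 i * v 0 i.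

Definition smooth_curve (S : set 'rV[R]_n) (q : 'rV[R]_n)
    (c : R -> 'rV[R]_n) : Prop :=
  c 0 = q /\ exists2 e : R, 0 < e &
    smooth_on (ball (0 : R) e) c /\ forall t, ball (0 : R) e t -> S (c t).

Definition tangent (S : set 'rV[R]_n) (q : 'rV[R]_n) : set 'rV[R]_n :=
  [set derive1 c 0 | c in smooth_curve S q].

(* nu is the unit normal of S at q that points into C. *)
Definition unit_normal (S C : set 'rV[R]_n) (q nu : 'rV[R]_n) : Prop :=
  [/\ dotv nu nu = 1,
      (forall v, tangent S q v -> dotv v nu = 0) &
      exists2 e : R, 0 < e & forall s : R, 0 < s < e -> C (q + s *: nu)].

(* The quadratic form of II q is the second fundamental form of S at q, for
   every q in S; here C is the convex side of S. Only the restriction of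
   II q to the tangent space of S at q is meaningful. *)
Definition second_fundamental_form (S C : set 'rV[R]_n)
    (II : 'rV[R]_n -> 'M[R]_n) : Prop :=
  forall q, S q -> exists2 nu, unit_normal S C q nu &
    forall c, smooth_curve S q c ->
      qform (II q) (derive1 c 0) = dotv (derive1n 2 c 0) nu.

(* Equality, up to a positive function, of the restrictions to the tangent
   spaces of S. *)
Definition conformal_on (S : set 'rV[R]_n) (B1 B2 : 'rV[R]_n -> 'M[R]_n) :
    Prop :=
  exists lambda : 'rV[R]_n -> R, forall q, S q ->
    0 < lambda q /\
    forall v, tangent S q v -> qform (B1 q) v = lambda q * qform (B2 q) v.

End Hypersurface.

Section Projective.
Context {R : realType} {n : nat}.

(* Points of RP^n are the lines of R^(n+1); this is [x_1 : ... : x_n : 1]. *)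
Definition proj_pt (x : 'rV[R]_n) : {vspace 'rV[R]_(n + 1)} :=
  <[row_mx x 1%:M]>%VS.

(* GL(n+1, R) acts on the left on column vectors, whence the transposition. *)
Definition proj_act (A : 'M[R]_(n + 1)) (L : {vspace 'rV[R]_(n + 1)}) :
    {vspace 'rV[R]_(n + 1)} :=
  (linfun (mulmxr A^T) @: L)%VS.

(* PGL(n+1, R) = GL(n+1, R) / R^*; its elements are the classes of invertible
   matrices up to nonzero scalars. *)
Definition PGL : set (set 'M[R]_(n + 1)) :=
  [set [set c *: A | c in [set c : R | c != 0]] |
    A in [set A : 'M[R]_(n + 1) | A \in unitmx]].

(* The action of A read in the affine patch R^n, see proj_act_pt. *)
Definition affine_act (A : 'M[R]_(n + 1)) (x : 'rV[R]_n) : 'rV[R]_n :=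
  let y := row_mx x 1%:M *m A^T in (rsubmx y 0 0)^-1 *: lsubmx y.

Lemma proj_act_pt (A : 'M[R]_(n + 1)) (x : 'rV[R]_n) :
  rsubmx (row_mx x 1%:M *m A^T) 0 0 != 0 ->
  proj_act A (proj_pt x) = proj_pt (affine_act A x).
Proof.
move=> y0; rewrite /proj_act /proj_pt limg_line lfunE /= /affine_act.
set y := row_mx _ _ *m _ in y0 *; set a := rsubmx y 0 0 in y0 *.
have -> : row_mx (a^-1 *: lsubmx y) 1%:M = a^-1 *: y.
  rewrite -[in RHS](hsubmxK y) scale_row_mx; congr row_mx.
  by apply/matrixP => i j; rewrite !ord1 [LHS]mxE eqxx [RHS]mxE -/a mulVf.
apply/eqP; rewrite eqEsubv -!memvE memvZ ?memv_line // andbT.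
by apply/vlineP; exists a; rewrite scalerA mulfV // scale1r.
Qed.

End Projective.

Section GeneralizedCusp.
Context {R : realType} {n : nat}.
Implicit Types (psi : {scalar 'rV[R]_n}) (x : 'rV[R]_n).

Definition coef psi (i : 'I_n) : R := psi (delta_mx 0 i).

(* The closed Weyl chamber A. *)
Definition chamber : set {scalar 'rV[R]_n} :=
  [set psi | (forall i j : 'I_n, (i <= j)%N -> coef psi j <= coef psi i) /\
             (forall i, 0 <= coef psi i)].

Definition cusp_type psi : nat := #|[set i | 0 < coef psi i]%SET|.

Definition cusp_V psi : set 'rV[R]_n :=
  [set x | forall i : 'I_n, (i < cusp_type psi)%N -> 0 < x 0 i].

(* insub t = Some k, with k the element of 'I_n of value t, exactly when
   t < n. *)
Definition cusp_h psi x : R :=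
  if (insub (cusp_type psi) : option 'I_n) is Some k then
    - x 0 k - \sum_(i < n | (i < cusp_type psi)%N) coef psi i * ln (x 0 i)
    + 2^-1 * \sum_(i < n | (cusp_type psi < i)%N) x 0 i ^+ 2
  else - (\sum_i coef psi i)^-1 * \sum_i coef psi i * ln (x 0 i).

Definition level psi (c : R) : set 'rV[R]_n :=
  [set x | cusp_V psi x /\ cusp_h psi x = c].

Definition cusp_domain psi : set 'rV[R]_n :=
  [set x | cusp_V psi x /\ cusp_h psi x <= 0].

Definition cusp_boundary psi : set 'rV[R]_n := level psi 0.

Definition cusp_group psi : set (set 'M[R]_(n + 1)) :=
  [set g | PGL g /\ forall A, g A -> forall c : R,
     proj_act A @` (@proj_pt R n @` level psi c) = @proj_pt R n @` level psi c].

Definition radial_flow psi (t : R) x : 'rV[R]_n :=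
  if (insub (cusp_type psi) : option 'I_n) is Some k then
    x - t *: delta_mx 0 k
  else expR (- t) *: x.

Definition group_invariant psi (beta : 'rV[R]_n -> 'M[R]_n) : Prop :=
  forall g, cusp_group psi g -> forall A, g A ->
  forall x, cusp_domain psi x -> pullback (affine_act A) beta x = beta x.

Definition flow_invariant psi (beta : 'rV[R]_n -> 'M[R]_n) : Prop :=
  forall (t : R) x, cusp_domain psi x -> cusp_domain psi (radial_flow psi t x) ->
    pullback (radial_flow psi t) beta x = beta x.

End GeneralizedCusp.

(* Main.v *)
Require Import Defs.
From HB Require Import structures.
From mathcomp Require Import all_boot all_order all_algebra.
From mathcomp Require Import all_classical all_reals all_analysis.
From mathcomp Require Import ring lra.

(* The height h is a sum of functions of one variable, and its affine Hessian
   D^2 h = sum_(i < t) p_i dx_i^2 / x_i^2 + sum_(i > t) dx_i^2 is diagonal. Take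
   beta = D^2 h if t = n, and beta = D^2 h + dh^2 if t < n. In the coordinates
   sqrt p_i ln x_i, x_i, and - h, it becomes the Euclidean metric, and Omega the
   half space <u, v> >= 0 for a unit vector v, which an orthogonal map sends to
   R^(n-1) x [0, oo).
   An affine map that changes h by a constant preserves D^2 h and dh^2. The
   radial flow consists of such maps; so does G(psi), since a projective map
   preserving h is affine.
   Differentiating h(c(t)) = 0 twice along a curve of the boundary gives
   <c'', - grad h / |grad h|> = D^2 h(c', c') / |grad h|, so that the second
   fundamental form is D^2 h / |grad h|. *)

Set Implicit Arguments.
Unset Strict Implicit.
Unset Printing Implicit Defensive.

Import Order.TTheory GRing.Theory Num.Theory.
Import numFieldNormedType.Exports.
Local Open Scope classical_set_scope.
Local Open Scope ring_scope.

(** * Directional derivatives, and their dependence on local values only *)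

Section DirectionalDerivatives.
Context {R : realType}.

(** Both sides are limits of the same difference quotient. This reduces directional derivatives to
    calculus in one variable, in particular the chain rule below. *)
Lemma is_derive_line {V W : normedModType R} (f : V -> W) (x v : V) (a : W) :
  is_derive x v f a <-> is_derive (0 : R) 1 (fun h => f (h *: v + x)) a.
Proof.
have E : 'D_1 (fun h : R => f (h *: v + x)) 0 = 'D_v f x.
  rewrite /derive; set g1 := fun h => h^-1 *: _; set g2 := fun h => h^-1 *: _.
  suff -> : g1 = g2 by [].
  apply/funext => h; rewrite /g1 /g2 /=.
  by rewrite addr0 scale0r add0r [_%:A]mulr1.
split=> -[df dfE]; split.
- exact: (derivable1P f x v).1.
- by rewrite E.
- exact: (derivable1P f x v).2.
- by rewrite -E.
Qed.

Lemma is_derive_comp {V : normedModType R} (g : R -> R) (f : V -> R) (x v : V)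
    (a b : R) :
  is_derive (f x) 1 g a -> is_derive x v f b -> is_derive x v (g \o f) (a * b).
Proof.
move=> gf /is_derive_line fx; apply/is_derive_line.
have gf' : is_derive (f ((0 : R) *: v + x)) 1 g a by rewrite scale0r add0r.
exact: (@is_derive1_comp _ g (fun h => f (h *: v + x))).
Qed.

(** Later identities between first and second derivatives come from differentiating two locally
    equal expressions. *)
Lemma is_derive_unique {V W : normedModType R} (f g : V -> W) (x v : V)
    (a b : W) :
  {near x, f =1 g} -> is_derive x v f a -> is_derive x v g b -> a = b.
Proof. by move=> /near_eq_is_derive fg /fg[_ <-] [_ <-]. Qed.

(** The first-order expansion of [f] at [x] is also one of [g], and such an expansion determines the
    differential. *)
Lemma near_eq_differentiable {V W : normedModType R} (f g : V -> W) (x : V) :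
  {near x, f =1 g} -> differentiable f x -> differentiable g x.
Proof.
move=> fg /diff_locallyP[df /eqaddoP fE].
have fgx : f x = g x by exact: nbhs_singleton fg.
have gE : g \o shift x = cst (g x) + 'd f x +o_ 0 id.
  apply/eqaddoP => e e0; have {}fE := fE _ e0.
  have {}fg : \forall h \near (0 : V), f (h + x) = g (h + x).
    have := fg; rewrite [X in X -> _](near_shift 0 x).
    by apply: filterS => h /=; rewrite subr0.
  apply: filterS2 fE fg => h fE fg.
  by move: fE; rewrite !fctE /= fg fgx.
have dg : 'd g x = 'd f x :> (V -> W) by exact: diff_unique gE.
by apply/diff_locallyP; rewrite dg.
Unshelve. all: by end_near. Qed.

(** Serves to show that the unit normal of the boundary points into the domain. *)
Lemma is_derive_lt0 (f : R -> R) (a : R) : is_derive (0 : R) 1 f a -> a < 0 ->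
  \forall s \near 0^'+, f s < f 0.
Proof.
move=> [df <-] a0.
have /cvg_dnbhs_at_right/cvgr_lt/(_ _ a0) :
    h^-1 *: (f (h *: 1 + 0) - f 0) @[h --> 0^'] --> 'D_1 f (0 : R) by exact: df.
move=> flt; near=> s.
have s0 : 0 < s by [].
have : s^-1 * (f (s * 1 + 0) - f 0) < 0 by near: s.
by rewrite mulr1 addr0 pmulr_rlt0 ?invr_gt0 // subr_lt0.
Unshelve. all: by end_near. Qed.

End DirectionalDerivatives.

(** * A class of smooth functions closed under differentiation *)

Section Elementary.
Context {R : realType} {n : nat}.

Lemma is_derive_coord (x v : 'rV[R]_n) (i : 'I_n) :
  is_derive x v (fun y : 'rV[R]_n => y 0 i) (v 0 i).
Proof.
split; first exact/diff_derivable/differentiable_coord.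
have /derive_mx/(congr1 (fun A : 'rV[R]_n => A 0 i)) :
  derivable (@id 'rV[R]_n) x v by exact: derivable_id.
by rewrite derive_id mxE => ->.
Qed.

Implicit Types (U : set 'rV[R]_n) (f g : 'rV[R]_n -> R).

(* Closed under every 'D_v, which makes all its members smooth. *)
Inductive elementary U : ('rV[R]_n -> R) -> Prop :=
| elementary_cst (a : R) : elementary U (cst a)
| elementary_coord i : elementary U (fun x => x 0 i)
| elementaryD f g : elementary U f -> elementary U g ->
    elementary U (fun x => f x + g x)
| elementaryM f g : elementary U f -> elementary U g ->
    elementary U (fun x => f x * g x)
| elementary_expR f : elementary U f -> elementary U (fun x => expR (f x))
| elementary_ln f : elementary U f -> (forall x, U x -> 0 < f x) ->
    elementary U (fun x => ln (f x))
| elementaryV f : elementary U f -> (forall x, U x -> f x != 0) ->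
    elementary U (fun x => (f x)^-1).

Lemma elementary_sum U (I : Type) (r : seq I) (P : pred I)
    (F : I -> 'rV[R]_n -> R) :
  (forall i, P i -> elementary U (F i)) ->
  elementary U (fun x => \sum_(i <- r | P i) F i x).
Proof.
move=> FU; elim: r => [|i r IH].
  rewrite (_ : (fun _ => _) = cst 0); first exact: elementary_cst.
  by apply/funext => x; rewrite big_nil.
case: (boolP (P i)) => Pi.
  rewrite (_ : (fun _ => _) = fun x => F i x + \sum_(j <- r | P j) F j x).
    by apply: elementaryD => //; exact: FU.
  by apply/funext => x; rewrite big_cons Pi.
rewrite (_ : (fun _ => _) = fun x => \sum_(j <- r | P j) F j x) //.
by apply/funext => x; rewrite big_cons (negbTE Pi).
Qed.

Lemma elementaryZ U (a : R) f :
  elementary U f -> elementary U (fun x => a * f x).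
Proof. by move=> fU; apply: elementaryM => //; exact: elementary_cst. Qed.

Lemma elementary_differentiable U f x :
  elementary U f -> U x -> differentiable f x.
Proof.
move=> fU Ux; elim: fU => {f} [a|i|f g _ df _ dg|f g _ df _ dg|f _ df
  |f _ df f0|f _ df f0].
- exact: differentiable_cst.
- exact: differentiable_coord.
- exact: differentiableD.
- exact: differentiableM.
- apply: (@differentiable_comp _ _ _ _ f (@expR R)) => //.
  by apply/derivable1_diffP; exact: derivable_expR.
- apply: (@differentiable_comp _ _ _ _ f (@ln R)) => //.
  by apply/derivable1_diffP; apply: ex_derive; apply: is_derive1_ln; exact: f0.
- by apply: differentiableV => //; exact: f0.
Qed.

(** One differentiation rule for each constructor. The derivative is given by a second function
    because ['D_v f] is only known to agree with an elementary one on [U]. *)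
Lemma elementary_derive U f v : elementary U f ->
  exists2 f', elementary U f' & forall x, U x -> is_derive x v f (f' x).
Proof.
elim=> {f} [a|i|f g fU [f' f'U ff'] gU [g' g'U gg']
  |f g fU [f' f'U ff'] gU [g' g'U gg']|f fU [f' f'U ff']
  |f fU [f' f'U ff'] f0|f fU [f' f'U ff'] f0].
- by exists (cst 0) => [|x _]; [exact: elementary_cst|exact: is_derive_cst].
- exists (cst (v 0 i)) => [|x _]; first exact: elementary_cst.
  exact: is_derive_coord.
- exists (fun x => f' x + g' x); first exact: elementaryD.
  by move=> x Ux; apply: is_deriveD; [exact: ff'|exact: gg'].
- exists (fun x => f x * g' x + g x * f' x).
    by apply: elementaryD; apply: elementaryM.
  by move=> x Ux; apply: is_deriveM; [exact: ff'|exact: gg'].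
- exists (fun x => expR (f x) * f' x).
    by apply: elementaryM => //; exact: elementary_expR.
  move=> x Ux; apply: is_derive_comp; exact: ff'.
- exists (fun x => (f x)^-1 * f' x).
    apply: elementaryM => //; apply: elementaryV => // x /f0.
    exact: lt0r_neq0.
  move=> x Ux; apply: is_derive_comp; last exact: ff'.
  by apply: is_derive1_ln; exact: f0.
- exists (fun x => -1 * ((f x)^-1 * (f x)^-1) * f' x).
    apply: elementaryM => //; apply: elementaryZ.
    by apply: elementaryM; apply: elementaryV.
  move=> x Ux; apply: (@is_derive_comp _ _ GRing.inv f); last exact: ff'.
  have := @is_deriveV R id (f x) 1 1 (f0 _ Ux) (is_derive_id _ _).
  by rewrite mulN1r -expr2 exprVn [_ *: 1]mulr1.
Qed.

Definition elementary_mx U {p q} (F : 'rV[R]_n -> 'M[R]_(p, q)) :=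
  forall i j, elementary U (fun x => F x i j).

Lemma elementary_mx_differentiable U {p q} (F : 'rV[R]_n -> 'M[R]_(p, q)) x :
  elementary_mx U F -> U x -> differentiable F x.
Proof.
move=> FU Ux.
rewrite (_ : F = \sum_i \sum_j (fun y => F y i j *: delta_mx i j)).
  apply: differentiable_sum => i; apply: differentiable_sum => j.
  by apply: differentiableZl; apply: elementary_differentiable Ux.
apply/funext => y; rewrite [LHS]matrix_sum_delta fct_sumE.
by apply: eq_bigr => i _; rewrite fct_sumE.
Qed.

Lemma elementary_mx_derive U {p q} (F : 'rV[R]_n -> 'M[R]_(p, q)) v :
  elementary_mx U F ->
  exists2 F', elementary_mx U F' & forall x, U x -> 'D_v F x = F' x.
Proof.
move=> FU.
have /choice[F' F'E] (ij : 'I_p * 'I_q) : exists f', elementary U f' /\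
    forall x, U x -> is_derive x v (fun y => F y ij.1 ij.2) (f' x).
  by have [f'] := elementary_derive v (FU ij.1 ij.2); exists f'.
exists (fun x => \matrix_(i, j) F' (i, j) x) => [i j|x Ux].
  rewrite (_ : (fun _ => _) = F' (i, j)); first by have [] := F'E (i, j).
  by apply/funext => x; rewrite mxE.
rewrite derive_mx; last exact/diff_derivable/elementary_mx_differentiable.
by apply/matrixP => i j; rewrite !mxE; have [_ /(_ _ Ux)[]] := F'E (i, j).
Qed.

(** By induction on the list of directions, every iterated derivative agrees on [U] with an
    elementary matrix. As [U] is open, the agreement is local and passes to the next derivative. *)
Lemma elementary_mx_smooth U {p q} (F : 'rV[R]_n -> 'M[R]_(p, q)) :
  open U -> elementary_mx U F -> smooth_on U F.
Proof.
move=> Uo FU s x Ux.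
have [F' F'U FF'] : exists2 F' : 'rV[R]_n -> 'M[R]_(p, q), elementary_mx U F' &
    forall y, U y -> foldr (fun v G => 'D_v G) F s y = F' y.
  elim: s => [|v s [F' F'U FF']] /=; first by exists F.
  have [F'' F''U F'F''] := elementary_mx_derive v F'U.
  exists F'' => // y Uy; rewrite -F'F'' //; apply: near_eq_derive.
  near=> z; apply: FF'; near: z; exact: open_nbhs_nbhs.
apply: (@near_eq_differentiable _ _ _ F').
  near=> z; rewrite FF' //; near: z; exact: open_nbhs_nbhs.
exact: elementary_mx_differentiable Ux.
Unshelve. all: by end_near. Qed.

End Elementary.

(** * Quadratic forms and the scalar product *)

Section QuadraticForms.
Context {R : realType} {n : nat}.
Implicit Types (B C M : 'M[R]_n) (u v : 'rV[R]_n).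

Lemma qformD B C u : qform (B + C) u = qform B u + qform C u.
Proof. by rewrite /qform mulmxDr mulmxDl mxE. Qed.

Lemma qformZ (a : R) B u : qform (a *: B) u = a * qform B u.
Proof. by rewrite /qform -scalemxAr -scalemxAl mxE. Qed.

Lemma qform_congr B M u : qform (M *m B *m M^T) u = qform B (u *m M).
Proof. by rewrite /qform trmx_mul !mulmxA. Qed.

Lemma dotvE u v : dotv u v = (u *m v^T) 0 0.
Proof. by rewrite mxE; apply: eq_bigr => i _; rewrite mxE. Qed.

Lemma dotvC u v : dotv u v = dotv v u.
Proof. by apply: eq_bigr => i _; rewrite mulrC. Qed.

Lemma dotvZl (a : R) u v : dotv (a *: u) v = a * dotv u v.
Proof. by rewrite /dotv mulr_sumr; apply: eq_bigr => i _; rewrite mxE mulrA. Qed.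

Lemma dotvBl u u' v : dotv (u - u') v = dotv u v - dotv u' v.
Proof.
by rewrite /dotv -sumrB; apply: eq_bigr => i _; rewrite !mxE mulrBl.
Qed.

Lemma dotvDl u u' v : dotv (u + u') v = dotv u v + dotv u' v.
Proof. by rewrite !dotvE mulmxDl mxE. Qed.

Lemma dotv_ge0 u : 0 <= dotv u u.
Proof. by apply: sumr_ge0 => i _; rewrite -expr2 sqr_ge0. Qed.

Lemma dotv_eq0 u : (dotv u u == 0) = (u == 0).
Proof.
apply/idP/eqP => [|->]; last by apply/eqP; apply: big1 => i _; rewrite mxE mul0r.
rewrite psumr_eq0 => [/allP u0|i _]; last by rewrite -expr2 sqr_ge0.
apply/rowP => i; rewrite mxE; apply/eqP.
by have := u0 i; rewrite mem_index_enum mulf_eq0 orbb => /(_ isT).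
Qed.

Lemma dotv_delta u i : dotv u (delta_mx 0 i) = u 0 i.
Proof. by rewrite dotvE trmx_delta -colE mxE. Qed.

Lemma dotv_deltal i u : dotv (delta_mx 0 i) u = u 0 i.
Proof. by rewrite dotvC dotv_delta. Qed.

Lemma dotv_mulmx u v (Q : 'M[R]_n) : dotv u (v *m Q) = dotv (u *m Q^T) v.
Proof. by rewrite !dotvE trmx_mul mulmxA. Qed.

Lemma line_entry u v (s : R) i : (u + s *: v) 0 i = u 0 i + s * v 0 i.
Proof. by rewrite !mxE. Qed.

Lemma qform_outer u v : qform (v^T *m v) u = dotv u v ^+ 2.
Proof.
by rewrite /qform mulmxA -mulmxA mxE big_ord1 -!dotvE (dotvC v) expr2.
Qed.

Lemma qform_diag (d u : 'rV[R]_n) :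
  qform (diag_mx d) u = \sum_i d 0 i * u 0 i ^+ 2.
Proof.
rewrite /qform mul_mx_diag mxE; apply: eq_bigr => i _.
by rewrite !mxE expr2 mulrA (mulrC (d 0 i)).
Qed.

(** Polarization: the value at [e_i + e_j] determines the entry of index [i], [j]. *)
Lemma qform_inj B C :
  B^T = B -> C^T = C -> (forall u, qform B u = qform C u) -> B = C.
Proof.
move=> BT CT BC; apply/matrixP => i j.
have E (A : 'M[R]_n) : A^T = A -> qform A (delta_mx 0 i + delta_mx 0 j) =
    qform A (delta_mx 0 i) + qform A (delta_mx 0 j) + 2 * A i j.
  move=> AT; have Aij k l :
      (delta_mx (0 : 'I_1) k *m A *m (delta_mx (0 : 'I_1) l)^T) 0 0 = A k l.
    by rewrite -rowE trmx_delta -colE !mxE.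
  have Aji : A j i = A i j by rewrite -[in LHS]AT mxE.
  rewrite /qform linearD /= !mulmxDl !mulmxDr [in LHS]mxE [X in X + _]mxE [X in _ + X]mxE.
  rewrite !Aij Aji; ring.
have := BC (delta_mx 0 i + delta_mx 0 j).
rewrite !E // !BC => /addrI; by apply: mulfI; rewrite pnatr_eq0.
Qed.

End QuadraticForms.

(** * Jacobian matrices and derivatives of vector-valued maps *)

Section Jacobian.
Context {R : realType} {n : nat}.

Lemma jacobian_derive (F : 'rV[R]_n -> 'rV[R]_n) (x : 'rV[R]_n)
    (J : 'M[R]_n) :
  differentiable F x -> (forall v, 'D_v F x = v *m J) -> 'J F x = J.
Proof.
move=> dF FJ; apply/row_matrixP => i.
by rewrite !rowE -deriveEjacobian // FJ.
Qed.

Lemma is_derive_row {V : normedModType R} (F : V -> 'rV[R]_n) (x v : V)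
    (d : 'rV[R]_n) :
  (forall i, is_derive x v (fun y => F y 0 i) (d 0 i)) -> is_derive x v F d.
Proof.
move=> Fd; have dF : derivable F x v.
  by apply/derivable_mxP => i j; rewrite (ord1 i); exact: ex_derive.
split=> //; rewrite derive_mx //; apply/rowP => i.
by rewrite mxE; have [_ ->] := Fd i.
Qed.

Lemma is_derive_entry {V : normedModType R} (F : V -> 'rV[R]_n) (x v : V)
    (d : 'rV[R]_n) (i : 'I_n) :
  is_derive x v F d -> is_derive x v (fun y => F y 0 i) (d 0 i).
Proof.
move=> [dF FE]; split; first exact: (derivable_mxP F x v).1.
by rewrite -FE derive_mx // mxE.
Qed.

Lemma is_derive_mulmxr {V : normedModType R} (F : V -> 'rV[R]_n) (x v : V)
    (d : 'rV[R]_n) (Q : 'M[R]_n) :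
  is_derive x v F d -> is_derive x v (fun y => F y *m Q) (d *m Q).
Proof.
move=> Fd; apply: is_derive_row => j.
rewrite (_ : (fun _ => _) = \sum_k (Q k j \*: (fun y => F y 0 k))); last first.
  apply/funext => y; rewrite mxE fct_sumE.
  by apply: eq_bigr => k _; rewrite mulrC.
rewrite mxE (_ : \sum_k _ = \sum_k Q k j *: d 0 k); last first.
  by apply: eq_bigr => k _; rewrite mulrC.
by apply: is_derive_sum => k; apply: is_deriveZ; exact: is_derive_entry.
Qed.

Lemma elementary_mulmxr (U : set 'rV[R]_n) (F : 'rV[R]_n -> 'rV[R]_n)
    (Q : 'M[R]_n) :
  elementary_mx U F -> elementary_mx U (fun x => F x *m Q).
Proof.
move=> FU i j.
rewrite (_ : (fun _ => _) = fun y => \sum_k F y i k * Q k j).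
  apply: elementary_sum => k _; apply: elementaryM; first exact: FU.
  exact: elementary_cst.
by apply/funext => y; rewrite !mxE.
Qed.

Lemma elementary_id (U : set 'rV[R]_n) : elementary_mx U (@id 'rV[R]_n).
Proof. by move=> i j; rewrite (ord1 i); exact: elementary_coord. Qed.

Lemma jacobian_affine (M : 'M[R]_n) (b x : 'rV[R]_n) :
  'J (fun y => y *m M + b) x = M.
Proof.
apply: jacobian_derive => [|v].
  apply: differentiableD; last exact: differentiable_cst.
  apply: (@elementary_mx_differentiable _ _ setT) => //.
  exact/elementary_mulmxr/elementary_id.
have [_ ->] := is_deriveD (is_derive_mulmxr M (is_derive_id x v))
  (is_derive_cst b x v).
by rewrite addr0.
Qed.

End Jacobian.

(** * The height, its first two derivatives, and invariance of the metric under affine maps *)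

(* h is a sum of functions of one variable; p i stands for psi_i if t < n and
   for psi_i / (psi_1 + ... + psi_n) if t = n. *)
Section Separable.
Context {R : realType} {n : nat} (t : nat) (p : 'I_n -> R).
Implicit Types (i : 'I_n) (x u : 'rV[R]_n) (s : R).

Definition positive_cone : set 'rV[R]_n := [set x | forall i, (i < t)%N -> 0 < x 0 i].

Definition summand i s : R :=
  if (i < t)%N then - p i * ln s else if i == t :> nat then - s
  else 2^-1 * s ^+ 2.

Definition summand' i s : R :=
  if (i < t)%N then - p i * s^-1 else if i == t :> nat then -1 else s.

Definition summand'' i s : R :=
  if (i < t)%N then p i * (s^-1 * s^-1) else if i == t :> nat then 0 else 1.

Definition cusp_height x : R := \sum_i summand i (x 0 i).

Definition cusp_grad x : 'rV[R]_n := \row_i summand' i (x 0 i).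

Definition cusp_hess x : 'M[R]_n := diag_mx (\row_i summand'' i (x 0 i)).

(** The height is linear in the coordinate of index [t], so the Hessian degenerates in that
    direction. The square of the differential makes up for it; if [t] is [n] there is no such
    direction and the factor is 0. *)
Definition cusp_metric x : 'M[R]_n :=
  cusp_hess x + (t < n)%N%:R *: ((cusp_grad x)^T *m cusp_grad x).

Lemma near_cone x : positive_cone x -> \forall y \near x, positive_cone y.
Proof.
move=> xV.
have xi i : \forall y \near nbhs x, (i < t)%N -> 0 < (y : 'rV[R]_n) 0 i.
  have xi : \forall s \near x 0 i, (i < t)%N -> 0 < s.
    have [it|it] := boolP (i < t)%N; last by near=> s.
    by apply: filterS (lt_nbhsr (xV i it)).
  exact: (@coord_continuous R 1 n 0 i x _ xi).
exact: (filter_forall _ xi).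
Unshelve. all: by end_near. Qed.

Lemma open_cone : open positive_cone.
Proof. by rewrite openE => x; exact: near_cone. Qed.

Lemma near_cone_comp (c : R -> 'rV[R]_n) s :
  {for s, continuous c} -> positive_cone (c s) -> \forall r \near s, positive_cone (c r).
Proof. by move=> cs /near_cone; exact: cs. Qed.

Lemma is_derive_phi i s : ((i < t)%N -> 0 < s) ->
  is_derive s 1 (summand i) (summand' i s).
Proof.
rewrite /summand /summand'; case: ifP => _ s0; last case: ifP => _.
- by apply: is_deriveZ; apply: is_derive1_ln; exact: s0.
- exact: is_deriveNid.
- have := @is_deriveZ _ _ _ _ 2^-1 _ _ _ (is_deriveX 2 (is_derive_id s (1 : R))).
  by rewrite /GRing.scale /= expr1 mulr1 mulKf ?pnatr_eq0.
Qed.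

Lemma is_derive_phi' i s : ((i < t)%N -> 0 < s) ->
  is_derive s 1 (summand' i) (summand'' i s).
Proof.
rewrite /summand' /summand''; case: ifP => _ s0; last case: ifP => _.
- have s_neq0 : id s != 0 by rewrite gt_eqF // s0.
  have := @is_deriveZ _ _ _ _ (- p i) _ _ _
    (@is_deriveV R id s 1 1 s_neq0 (is_derive_id _ _)).
  by rewrite /GRing.scale /= mulr1 mulrNN -expr2 exprVn.
- exact: is_derive_cst.
- exact: is_derive_id.
Qed.

Lemma is_derive_height_comp (c : R -> 'rV[R]_n) (s : R) (d : 'rV[R]_n) :
  positive_cone (c s) -> (forall i, is_derive s 1 (fun r => c r 0 i) (d 0 i)) ->
  is_derive s 1 (fun r => cusp_height (c r)) (dotv d (cusp_grad (c s))).
Proof.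
move=> csV dc.
rewrite (_ : (fun _ => _) = \sum_i (summand i \o (fun r => c r 0 i))); last first.
  by apply/funext => r; rewrite fct_sumE.
apply: is_derive_eq.
  apply: (is_derive_sum (dh := fun i => summand' i (c s 0 i) * d 0 i)) => i.
  apply: (is_derive_comp (f := fun r => c r 0 i)).
  by apply: is_derive_phi; exact: csV.
by apply: eq_bigr => i _; rewrite mxE mulrC.
Qed.

Lemma qform_hess x u : qform (cusp_hess x) u = \sum_i summand'' i (x 0 i) * u 0 i ^+ 2.
Proof. by rewrite qform_diag; apply: eq_bigr => i _; rewrite mxE. Qed.

(** With [d] the velocity of [c] and [e] its acceleration, this is the second derivative of the
    height along [c]. *)
Lemma is_derive_dotv_grad_comp (c d : R -> 'rV[R]_n) (s : R) (e : 'rV[R]_n) :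
  positive_cone (c s) -> (forall i, is_derive s 1 (fun r => c r 0 i) (d s 0 i)) ->
  (forall i, is_derive s 1 (fun r => d r 0 i) (e 0 i)) ->
  is_derive s 1 (fun r => dotv (d r) (cusp_grad (c r)))
    (qform (cusp_hess (c s)) (d s) + dotv e (cusp_grad (c s))).
Proof.
move=> csV dc dd.
rewrite (_ : (fun _ => _) =
    \sum_i ((fun r => d r 0 i) * (summand' i \o (fun r => c r 0 i)))); last first.
  apply/funext => r; rewrite fct_sumE; apply: eq_bigr => i _.
  by rewrite mxE.
apply: is_derive_eq.
  apply: (is_derive_sum (dh := fun i => d s 0 i *: (summand'' i (c s 0 i) * d s 0 i)
    + summand' i (c s 0 i) *: e 0 i)) => i.
  apply: is_deriveM; apply: (is_derive_comp (f := fun r => c r 0 i)).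
  by apply: is_derive_phi'; exact: csV.
rewrite qform_hess /dotv -big_split /=; apply: eq_bigr => i _.
by rewrite mxE /GRing.scale /=; ring.
Qed.

Lemma qform_cusp_metric x u : qform (cusp_metric x) u =
  qform (cusp_hess x) u + (t < n)%N%:R * dotv u (cusp_grad x) ^+ 2.
Proof. by rewrite qformD qformZ qform_outer. Qed.

Lemma trmx_cusp_metric x : (cusp_metric x)^T = cusp_metric x.
Proof. by rewrite linearD linearZ /= trmx_mul trmxK tr_diag_mx. Qed.

Lemma is_derive_line_coord x u s i :
  is_derive s 1 (fun r => (x + r *: u) 0 i) (u 0 i).
Proof.
have := @is_deriveD _ _ _ _ _ s 1 _ _ (is_derive_cst (x 0 i) s (1 : R))
  (@is_deriveZ _ _ _ _ (u 0 i) _ _ _ (is_derive_id s (1 : R))).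
rewrite add0r [_ *: 1]mulr1; congr (is_derive _ _ _ _).
by apply/funext => r; rewrite !mxE mulrC.
Qed.

Lemma near_cone_line x u s : positive_cone (x + s *: u) ->
  \forall r \near s, positive_cone (x + r *: u).
Proof.
apply: (@near_cone_comp (fun r => x + r *: u)).
by apply: cvgD; [exact: cvg_cst|apply: cvgZr_tmp; exact: cvg_id].
Qed.

(** The image of a line is a line, and the heights along the two differ by the constant [k]. Hence
    their first and second derivatives agree. *)
Lemma qform_metric_affine (M : 'M[R]_n) (b : 'rV[R]_n) (k : R) x u :
  (forall y, positive_cone y -> positive_cone (y *m M + b) /\
     cusp_height (y *m M + b) = cusp_height y + k) ->
  positive_cone x -> qform (cusp_metric (x *m M + b)) (u *m M) = qform (cusp_metric x) u.
Proof.
move=> FV xV; pose c1 s := x + s *: u; pose c2 s := (x *m M + b) + s *: (u *m M).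
have c2E s : c2 s = c1 s *m M + b by rewrite /c2 /c1 mulmxDl -scalemxAl addrAC.
have Dc1 s i : is_derive s 1 (fun r => c1 r 0 i) (u 0 i).
  exact: is_derive_line_coord.
have Dc2 s i : is_derive s 1 (fun r => c2 r 0 i) ((u *m M) 0 i).
  exact: is_derive_line_coord.
(* Needed for all [s] near 0, since this equality is itself differentiated below. *)
have D1 s : positive_cone (c1 s) ->
    dotv u (cusp_grad (c1 s)) = dotv (u *m M) (cusp_grad (c2 s)).
  move=> sV.
  apply: (is_derive_unique (f := fun r => cusp_height (c1 r) + k)
                           (g := fun r => cusp_height (c2 r)) (x := s) (v := 1)).
  - near=> r; rewrite c2E; apply/esym; apply: (FV _ _).2.
    by near: r; exact: near_cone_line.
  - apply: is_derive_eq (addr0 _); apply: is_deriveD (is_derive_cst _ _ _).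
    exact: is_derive_height_comp.
  - by apply: is_derive_height_comp => //; rewrite c2E; exact: (FV _ _).1.
have c10 : c1 0 = x by rewrite /c1 scale0r addr0.
have c20 : c2 0 = x *m M + b by rewrite /c2 scale0r addr0.
have V0 : positive_cone (c1 0) by rewrite c10.
rewrite !qform_cusp_metric -c20 -c10 D1 //; congr (_ + _).
(* The velocity [w] is constant, so the acceleration term of the second derivative vanishes. *)
have D2 (c : R -> 'rV[R]_n) (w : 'rV[R]_n) : positive_cone (c 0) ->
    (forall i, is_derive (0 : R) 1 (fun r => c r 0 i) (w 0 i)) ->
    is_derive (0 : R) 1 (fun r => dotv w (cusp_grad (c r))) (qform (cusp_hess (c 0)) w).
  move=> cV dc; have w' i : is_derive (0 : R) 1 (fun=> w 0 i) ((0 : 'rV[R]_n) 0 i).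
    by rewrite mxE; exact: is_derive_cst.
  have := is_derive_dotv_grad_comp (d := fun=> w) cV dc w'.
  by rewrite [dotv 0 _]dotvE mul0mx mxE addr0.
apply: (is_derive_unique (f := fun r => dotv (u *m M) (cusp_grad (c2 r)))
  (g := fun r => dotv u (cusp_grad (c1 r))) (x := 0) (v := 1)).
- near=> r; apply/esym/D1; near: r; exact: near_cone_line.
- by apply: D2 => //; rewrite c2E; exact: (FV _ _).1.
- exact: D2.
Unshelve. all: by end_near. Qed.

(* Affine maps preserve second derivatives along lines, and those of the
   height determine the metric. *)
Lemma pullback_metric_affine (M : 'M[R]_n) (b : 'rV[R]_n) (k : R) x :
  (forall y, positive_cone y -> positive_cone (y *m M + b) /\
     cusp_height (y *m M + b) = cusp_height y + k) ->
  positive_cone x -> pullback (fun y => y *m M + b) cusp_metric x = cusp_metric x.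
Proof.
move=> FV xV; rewrite /pullback jacobian_affine.
apply: qform_inj; rewrite ?trmx_cusp_metric //.
  by rewrite !trmx_mul trmxK trmx_cusp_metric mulmxA.
by move=> u; rewrite qform_congr (qform_metric_affine u FV).
Qed.

End Separable.

(** * Positivity of the metric, and coordinates in which it is Euclidean *)

Section FlatCoordinates.
Context {R : realType} {n : nat} (t : nat) (p : 'I_n -> R).
Hypothesis p_gt0 : forall i : 'I_n, (i < t)%N -> 0 < p i.
Hypothesis sum_p : (n <= t)%N -> \sum_i p i = 1.
Implicit Types (i j : 'I_n) (x u w : 'rV[R]_n).

Local Notation cone := (@positive_cone R n t).
Local Notation phi := (summand t p).
Local Notation phi' := (summand' t p).
Local Notation phi'' := (summand'' t p).
Local Notation height := (cusp_height t p).
Local Notation grad := (cusp_grad t p).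
Local Notation hess := (cusp_hess t p).
Local Notation metric := (cusp_metric t p).

Lemma phi''_ge0 i x : cone x -> 0 <= phi'' i (x 0 i).
Proof.
move=> xV; rewrite /summand''; case: ifP => it; last by case: ifP.
by rewrite mulr_ge0 ?(ltW (p_gt0 it)) // -expr2 sqr_ge0.
Qed.

Lemma phi''_gt0 i x : cone x -> i != t :> nat -> 0 < phi'' i (x 0 i).
Proof.
move=> xV it'; rewrite /summand'' (negbTE it'); case: ifP => // it.
by rewrite mulr_gt0 ?p_gt0 // mulr_gt0 // invr_gt0 xV.
Qed.

Lemma qform_hess_ge0 x u : cone x -> 0 <= qform (hess x) u.
Proof.
move=> xV; rewrite qform_hess; apply: sumr_ge0 => i _.
by rewrite mulr_ge0 ?sqr_ge0 ?phi''_ge0.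
Qed.

(** If the form vanishes at [u], its Hessian part forces every entry of index other than [t] to be
    0. The other part is then the square of the entry of index [t]. *)
Lemma cusp_metric_gt0 x u : cone x -> u != 0 -> 0 < qform (metric x) u.
Proof.
move=> xV; have h0 := qform_hess_ge0 u xV.
have g0 : 0 <= (t < n)%N%:R * dotv u (grad x) ^+ 2.
  by apply: mulr_ge0; [exact: ler0n|exact: sqr_ge0].
rewrite qform_cusp_metric lt0r addr_ge0 // andbT; apply: contra.
rewrite paddr_eq0 // {h0 g0}.
rewrite qform_hess psumr_eq0 => [/andP[/allP u0 g0]|i _]; last first.
  by rewrite mulr_ge0 ?sqr_ge0 ?phi''_ge0.
have u0' i : i != t :> nat -> u 0 i = 0.
  move=> it; apply/eqP; have := u0 i; rewrite mem_index_enum => /(_ isT).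
  by rewrite mulf_eq0 gt_eqF ?phi''_gt0 //= sqrf_eq0.
apply/eqP/rowP => i; rewrite [RHS]mxE.
case: (eqVneq (i : nat) t) => [it|/u0' //].
move: g0; rewrite -it ltn_ord mul1r sqrf_eq0 /dotv (bigD1 i) //= big1 => [|j ji].
  by rewrite addr0 mxE /summand' it ltnn eqxx mulrN1 oppr_eq0 => /eqP.
by rewrite u0' ?mul0r // -it.
Qed.

(** The argument [f] is general because the inverse of the flat coordinates substitutes exponentials
    into the summands. *)
Lemma elementary_phi (U : set 'rV[R]_n) (f : 'rV[R]_n -> R) i :
  elementary U f -> (forall x, U x -> (i < t)%N -> 0 < f x) ->
  elementary U (fun x => phi i (f x)).
Proof.
rewrite /summand => fU f0; case it: (i < t)%N; last case: (i == t :> nat).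
- by apply/elementaryZ/elementary_ln => // x Ux; exact: f0.
- rewrite (_ : (fun _ => _) = fun x => -1 * f x); first exact: elementaryZ.
  by apply/funext => x; rewrite mulN1r.
- by apply: elementaryZ; apply: elementaryM.
Qed.

Lemma elementary_phi' i : elementary cone (fun x => phi' i (x 0 i)).
Proof.
rewrite /summand'; case it: (i < t)%N; last case: (i == t :> nat).
- apply/elementaryZ/elementaryV; first exact: elementary_coord.
  by move=> x xV; rewrite gt_eqF // xV.
- exact: elementary_cst.
- exact: elementary_coord.
Qed.

Lemma elementary_phi'' i : elementary cone (fun x => phi'' i (x 0 i)).
Proof.
rewrite /summand''; case it: (i < t)%N; last first.
  by case: (i == t :> nat); exact: elementary_cst.
apply/elementaryZ; apply: elementaryM; apply: elementaryV;
  (exact: elementary_coord || by move=> x xV; rewrite gt_eqF // xV).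
Qed.

Lemma elementary_height : elementary cone height.
Proof.
apply: elementary_sum => i _; apply: elementary_phi => [|x xV it].
  exact: elementary_coord.
exact: xV.
Qed.

Lemma elementary_metric : elementary_mx cone metric.
Proof.
move=> i j; rewrite (_ : (fun _ => _) = fun x =>
    (i == j)%:R * phi'' i (x 0 i) +
    (t < n)%N%:R * (phi' i (x 0 i) * phi' j (x 0 j))).
  apply: elementaryD; apply: elementaryZ; first exact: elementary_phi''.
  by apply: elementaryM; exact: elementary_phi'.
apply/funext => x; rewrite !mxE big_ord1 !mxE; congr (_ + _).
by rewrite mulr_natl.
Qed.

(* Flat coordinates: sqrt (p i) * ln x_i, whose differential squares to
   phi'' i (x_i) dx_i^2, and, in the direction of the radial flow if t < n,
   - height. *)
Definition flat x : 'rV[R]_n :=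
  \row_j if (j < t)%N then Num.sqrt (p j) * ln (x 0 j)
         else if j == t :> nat then - height x else x 0 j.

Definition flat_jacobian x : 'M[R]_n :=
  \matrix_(i, j) if j == t :> nat then - phi' i (x 0 i)
    else (i == j)%:R * (if (j < t)%N then Num.sqrt (p j) * (x 0 j)^-1 else 1).

(** In flat coordinates the radial flow at time [s] is the translation by [- s] times this vector,
    which is also the unit normal of the half space. *)
Definition flow_dir : 'rV[R]_n :=
  \row_j if (t < n)%N then (j == t :> nat)%:R else Num.sqrt (p j).

Definition unflat_coord w i : R :=
  if (i < t)%N then expR ((Num.sqrt (p i))^-1 * w 0 i) else w 0 i.

(** The entry of index [t] solves [- height x = w 0 t] for [x 0 t], which enters the height as
    [- x 0 t]. The other entries are inverted one at a time. *)
Definition unflat w : 'rV[R]_n :=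
  \row_j if j == t :> nat
         then w 0 j + \sum_(i < n | i != t :> nat) phi i (unflat_coord w i)
         else unflat_coord w j.

Lemma sqrt_neq0 i : (i < t)%N -> Num.sqrt (p i) != 0.
Proof. by move=> it; rewrite gt_eqF // sqrtr_gt0 p_gt0. Qed.

Lemma cone_unflat w : cone (unflat w).
Proof. by move=> i it; rewrite mxE (ltn_eqF it) /unflat_coord it expR_gt0. Qed.

Lemma unflat_coord_flat x i : cone x -> i != t :> nat ->
  unflat_coord (flat x) i = x 0 i.
Proof.
move=> xV it'; rewrite /unflat_coord mxE (negbTE it'); case it: (i < t)%N => //.
by rewrite mulKf ?sqrt_neq0 // lnK // posrE xV.
Qed.

Lemma flatK x : cone x -> unflat (flat x) = x.
Proof.
move=> xV; apply/rowP => j; rewrite mxE; case: ifPn => jt; last first.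
  exact: unflat_coord_flat.
rewrite (eq_bigr (fun i => phi i (x 0 i))) => [|i it]; last first.
  by rewrite unflat_coord_flat.
rewrite mxE (eqP jt) ltnn eqxx /cusp_height (bigD1 j) //=.
rewrite {1}/summand (eqP jt) ltnn eqxx.
rewrite opprD opprK -addrA -[RHS]addr0; congr (_ + _).
rewrite addrC; apply/eqP; rewrite subr_eq0; apply/eqP/eq_bigl => i.
by rewrite -(eqP jt).
Qed.

Lemma unflatK w : flat (unflat w) = w.
Proof.
apply/rowP => j; rewrite mxE; case: ifPn => jt.
  rewrite mxE (ltn_eqF jt) /unflat_coord jt expRK mulVKf //.
  exact: sqrt_neq0.
case: ifPn => jt'; last by rewrite mxE (negbTE jt') /unflat_coord (negbTE jt).
rewrite /cusp_height (bigD1 j) //= {1}/summand (negbTE jt) jt' mxE jt'.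
rewrite (eq_bigl (fun i => i != t :> nat)) => [|i]; last by rewrite -(eqP jt').
rewrite (eq_bigr (fun i => phi i (unflat w 0 i))) => [|i it].
  rewrite opprD opprK -addrA -[RHS]addr0; congr (_ + _).
  by apply/eqP; rewrite subr_eq0; apply/eqP/eq_bigr => i it; rewrite mxE (negbTE it).
by [].
Qed.

(** If [t] is [n], the squared length is the sum of the weights, normalized to 1. *)
Lemma dotv_flow_dir : dotv flow_dir flow_dir = 1.
Proof.
rewrite /dotv; case: (leqP n t) => [nt|tn]; last first.
  rewrite (bigD1 (Ordinal tn)) //= !mxE tn eqxx mulr1 big1 ?addr0 // => i it.
  by rewrite !mxE tn (negbTE (_ : i != t :> nat)) ?mul0r.
rewrite -[RHS](sum_p nt); apply: eq_bigr => i _.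
rewrite !mxE (leq_gtF nt) -expr2 sqr_sqrtr //.
by apply/ltW/p_gt0; exact: leq_trans nt.
Qed.

(** Turns the condition [height x <= 0] into a half space of the flat coordinates. *)
Lemma dotv_flat x : dotv (flat x) flow_dir = - height x.
Proof.
rewrite /dotv; case: (leqP n t) => [nt|tn]; last first.
  rewrite (bigD1 (Ordinal tn)) //= !mxE tn /= eqxx mulr1 ltnn big1 ?addr0 // => i it.
  by rewrite !mxE tn (negbTE (_ : i != t :> nat)) ?mulr0.
rewrite /cusp_height -sumrN; apply: eq_bigr => i _.
have it : (i < t)%N by exact: leq_trans nt.
rewrite !mxE (leq_gtF nt) /summand it mulNr opprK mulrAC -expr2 sqr_sqrtr //.
exact/ltW/p_gt0.
Qed.

Lemma is_derive_height x v : cone x -> is_derive x v height (dotv v (grad x)).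
Proof.
move=> xV; apply/is_derive_line.
have E : (fun h : R => h *: v + x) = (fun h => x + h *: v).
  by apply/funext => h; rewrite addrC.
have x0 : (0 : R) *: v + x = x by rewrite scale0r add0r.
have := @is_derive_height_comp _ _ t p (fun h : R => h *: v + x) 0 v.
rewrite x0; apply=> // i.
have -> : (fun h : R => (h *: v + x) 0 i) = (fun h => (x + h *: v) 0 i).
  by apply/funext => h; rewrite addrC.
exact: is_derive_line_coord.
Qed.

Lemma mul_flat_jacobian x v j : (v *m flat_jacobian x) 0 j =
  if j == t :> nat then - dotv v (grad x)
  else v 0 j * (if (j < t)%N then Num.sqrt (p j) * (x 0 j)^-1 else 1).
Proof.
rewrite mxE; case: ifPn => jt.
  by rewrite /dotv -sumrN; apply: eq_bigr => i _; rewrite !mxE jt mulrN.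
rewrite (bigD1 j) //= mxE (negbTE jt) eqxx mul1r big1 ?addr0 // => i ij.
by rewrite mxE (negbTE jt) (negbTE ij) mul0r mulr0.
Qed.

Lemma is_derive_flat x v : cone x -> is_derive x v flat (v *m flat_jacobian x).
Proof.
move=> xV; apply: is_derive_row => j; rewrite mul_flat_jacobian.
rewrite (_ : (fun _ => _) = fun y : 'rV[R]_n =>
         if (j < t)%N then Num.sqrt (p j) * ln (y 0 j)
         else if j == t :> nat then - height y else y 0 j); last first.
  by apply/funext => y; rewrite mxE.
case: (eqVneq (j : nat) t) => jt.
  rewrite jt ltnn; apply: is_deriveN; exact: is_derive_height.
case jt': (j < t)%N; last by rewrite mulr1; exact: is_derive_coord.
have := @is_deriveZ _ _ _ _ (Num.sqrt (p j)) x v _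
  (is_derive_comp (is_derive1_ln (xV j jt')) (is_derive_coord x v j)).
by rewrite /GRing.scale /= mulrA mulrC.
Qed.

Lemma flat_jacobian_gram x : cone x ->
  flat_jacobian x *m (flat_jacobian x)^T = metric x.
Proof.
move=> xV; apply: qform_inj; rewrite ?trmx_cusp_metric ?trmx_mul ?trmxK // => u.
rewrite -[X in X *m _]mulmx1 qform_congr qform_cusp_metric qform_hess.
rewrite /qform mulmx1 -dotvE /dotv.
(* Written as a sum over indices, the factor attaches the square of the differential to the index
   [t], and the two sides can be compared term by term. *)
have -> : (t < n)%N%:R = \sum_(j < n) (j == t :> nat)%:R :> R.
  case: (leqP n t) => [nt|tn]; last first.
    rewrite (bigD1 (Ordinal tn)) //= eqxx big1 ?addr0 // => i it.
    by rewrite (negbTE (_ : i != t :> nat)).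
  rewrite big1 // => i _; rewrite ltn_eqF //; exact: leq_trans nt.
rewrite mulr_suml -big_split /=; apply: eq_bigr => j _.
rewrite mul_flat_jacobian /summand''; case: ifPn => jt.
  by rewrite (eqP jt) ltnn mul0r add0r mul1r mulrNN expr2.
case: ifPn => jt'; last by rewrite mulr1 mul0r addr0 mul1r expr2.
rewrite mul0r addr0 -!expr2 exprMn [(_ * _) ^+ 2]exprMn sqr_sqrtr ?ltW ?p_gt0 //.
by rewrite mulrC.
Qed.

Lemma elementary_flat : elementary_mx cone flat.
Proof.
move=> i j.
rewrite (_ : (fun _ => _) = fun y : 'rV[R]_n =>
         if (j < t)%N then Num.sqrt (p j) * ln (y 0 j)
         else if j == t :> nat then -1 * height y else y 0 j); last first.
  by apply/funext => y; rewrite mxE mulN1r.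
case jt: (j < t)%N; last case: (j == t :> nat).
- apply/elementaryZ/elementary_ln => [|x]; [exact: elementary_coord|exact].
- exact/elementaryZ/elementary_height.
- exact: elementary_coord.
Qed.

Lemma elementary_unflat : elementary_mx setT unflat.
Proof.
have cE i : elementary setT (fun w => unflat_coord w i).
  rewrite /unflat_coord; case: (i < t)%N; last exact: elementary_coord.
  by apply/elementary_expR/elementaryZ; exact: elementary_coord.
move=> i j.
rewrite (_ : (fun _ => _) = fun w : 'rV[R]_n => if j == t :> nat
    then w 0 j + \sum_(i < n | i != t :> nat) phi i (unflat_coord w i)
    else unflat_coord w j); last by apply/funext => y; rewrite mxE.
case: (j == t :> nat); last exact: cE.
apply: elementaryD; first exact: elementary_coord.
apply: elementary_sum => k _; apply: elementary_phi => // w _ kt.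
by rewrite /unflat_coord kt expR_gt0.
Qed.

End FlatCoordinates.

(** * An orthogonal map sending a given unit vector to a basis vector *)

Section Householder.
Context {R : realType} {n : nat}.
Implicit Types (u v w : 'rV[R]_n).

(* Q is a Householder reflection. *)
Lemma exists_orthogonal v (l : 'I_n) : dotv v v = 1 ->
  exists2 Q : 'M[R]_n, Q *m Q^T = 1%:M & v *m Q = delta_mx 0 l.
Proof.
move=> v1; set e := delta_mx 0 l; have [->|ve] := eqVneq v e.
  by exists 1%:M; rewrite ?trmx1 mulmx1.
pose w := v - e; pose a := 2 / dotv w w.
have w0 : dotv w w != 0 by rewrite dotv_eq0 subr_eq0.
have ee : dotv e e = 1 by rewrite dotv_delta mxE !eqxx.
(* Holds because [v] and [e] have length 1. It makes the reflection subtract exactly [w] from [v],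
   which leaves [e]. *)
have ww : dotv w w = 2 * dotv v w.
  by rewrite /w !dotvBl !(dotvC _ (v - e)) !dotvBl v1 ee (dotvC e v); ring.
have aw : a * dotv v w = 1 by rewrite /a mulrAC -ww divff.
pose Q : 'M[R]_n := 1%:M - a *: (w^T *m w).
have QT : Q^T = Q by rewrite /Q linearB /= trmx1 linearZ /= trmx_mul trmxK.
exists Q; rewrite ?QT.
  have WW : (w^T *m w) *m (w^T *m w) = dotv w w *: (w^T *m w).
    rewrite mulmxA -(mulmxA w^T) (mx11_scalar (w *m w^T)) -dotvE.
    by rewrite mul_mx_scalar -scalemxAl.
  have aw2 : a * dotv w w = 2 by rewrite /a divfK.
  rewrite {2}/Q mulmxBr mulmx1 -scalemxAr /Q mulmxBl mul1mx -scalemxAl WW.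
  by rewrite scalerA aw2 scaler_nat mulr2n opprD addrA subrr sub0r scalerN opprK
    subrK.
rewrite /Q mulmxBr mulmx1 -scalemxAr mulmxA (mx11_scalar (v *m w^T)) -dotvE.
by rewrite mul_scalar_mx scalerA aw scale1r /w subKr.
Qed.

End Householder.

Lemma elementary_comp_mulmx {R : realType} {n : nat} (U : set 'rV[R]_n)
    (Q : 'M[R]_n) (f : 'rV[R]_n -> R) :
  elementary U f -> elementary [set y | U (y *m Q)] (fun y => f (y *m Q)).
Proof.
elim=> {f} [a|i|f g _ fU _ gU|f g _ fU _ gU|f _ fU|f _ fU f0|f _ fU f0].
- exact: elementary_cst.
- exact/elementary_mulmxr/elementary_id.
- exact: elementaryD.
- exact: elementaryM.
- exact: elementary_expR.
- by apply: elementary_ln => // y; exact: f0.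
- by apply: elementaryV => // y; exact: f0.
Qed.

(** Smoothness is applied to the empty list of directions, for the curve, and to [[:: 1]], for its
    velocity. *)
Lemma smooth_curve_derive {R : realType} {n : nat} (S : set 'rV[R]_n) (q : 'rV[R]_n)
    (c : R -> 'rV[R]_n) :
  smooth_curve S q c ->
  [/\ c 0 = q, \forall s \near (0 : R), S (c s) /\ is_derive s 1 c (derive1 c s) &
      is_derive (0 : R) 1 (derive1 c) (derive1n 2 c 0)].
Proof.
move=> [c0 [e e0 [cs cS]]]; split; first exact: c0.
  near=> s; have se : ball (0 : R) e s by near: s; exact: nbhsx_ballx.
  split; first exact: cS.
  by rewrite derive1E; apply/derivableP/diff_derivable; exact: (cs [::] s se).
rewrite derive1nS derive1n1 derive1E; apply/derivableP/diff_derivable.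
have -> : c^`()%classic = 'D_1 c by apply/funext => s; rewrite derive1E.
exact: (cs [:: 1] 0 (ballxx _ e0)).
Unshelve. all: by end_near. Qed.

(** * The isometry with the half space, and the second fundamental form *)

Section CuspDomain.
Context {R : realType} {n : nat} (t : nat) (p : 'I_n -> R).
Hypothesis p_gt0 : forall i : 'I_n, (i < t)%N -> 0 < p i.
Hypothesis sum_p : (n <= t)%N -> \sum_i p i = 1.
Implicit Types (i j : 'I_n) (x u w : 'rV[R]_n).

Local Notation cone := (@positive_cone R n t).
Local Notation height := (cusp_height t p).
Local Notation grad := (cusp_grad t p).
Local Notation hess := (cusp_hess t p).
Local Notation metric := (cusp_metric t p).
Local Notation domain := [set x | cone x /\ height x <= 0].
Local Notation boundary := [set x | cone x /\ height x = 0].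

Lemma riemannian_cusp_metric : riemannian_metric domain metric.
Proof.
split=> [x [xV _]|x [xV _]].
  exists cone, metric; split => //; first exact: open_cone.
  apply: elementary_mx_smooth; first exact: open_cone.
  exact: elementary_metric.
by split=> [|u]; [exact: trmx_cusp_metric|exact: cusp_metric_gt0].
Qed.

(** The isometry is the flat chart followed by an orthogonal map, which cancels in the Gram matrix.
    Its formula is smooth on the whole open cone and so extends it past the boundary. *)
Lemma isometric_half_space : (0 < n)%N ->
  isometric domain metric half_space euclidean.
Proof.
move=> n0; have ln : (n.-1 < n)%N by rewrite prednK.
have [Q QQ vQ] := exists_orthogonal (Ordinal ln) (dotv_flow_dir p_gt0 sum_p).
have QQ' : Q^T *m Q = 1%:M by exact: mulmx1C.
(* [Q] sends [flow_dir] to the last basis vector, so the last coordinate of an image point is minus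
   the height. *)
have lastE (y : 'rV[R]_n) : y 0 (Ordinal ln) = dotv (y *m Q^T) (flow_dir t p).
  by rewrite -dotv_mulmx vQ dotv_delta.
have halfE (y : 'rV[R]_n) : half_space y <-> 0 <= y 0 (Ordinal ln).
  split=> [|y0 i il]; first exact.
  by rewrite (_ : i = Ordinal ln) //; exact: val_inj.
exists (fun x => flat t p x *m Q), (fun y => unflat t p (y *m Q^T)).
split=> [x [xV hx]|y /halfE|y _|x [xV hx]].
- split; last by rewrite -mulmxA QQ mulmx1 flatK.
  by apply/halfE; rewrite lastE -mulmxA QQ mulmx1 dotv_flat // oppr_ge0.
- rewrite lastE => y0; split; last by rewrite unflatK // -mulmxA QQ' mulmx1.
  split; first exact: cone_unflat.
  by rewrite -oppr_ge0 -(dotv_flat p_gt0) unflatK.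
- exists setT, (fun y => unflat t p (y *m Q^T)); split => //; first exact: openT.
  apply: elementary_mx_smooth; first exact: openT.
  move=> i j; apply: (@elementary_comp_mulmx _ _ setT Q^T (fun w => unflat t p w i j)).
  exact: elementary_unflat.
- exists cone, (fun x => flat t p x *m Q).
  have fU : elementary_mx cone (fun x => flat t p x *m Q).
    exact/elementary_mulmxr/elementary_flat.
  split.
    split => //; first exact: open_cone.
    by apply: elementary_mx_smooth => //; exact: open_cone.
  rewrite /pullback (_ : 'J _ _ = flat_jacobian t p x *m Q).
    rewrite mulmx1 trmx_mul mulmxA -(mulmxA _ Q) QQ mulmx1.
    exact: flat_jacobian_gram.
  apply: jacobian_derive => [|v].
    exact: elementary_mx_differentiable xV.
  have [_ ->] := is_derive_mulmxr Q (is_derive_flat p v xV).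
  by rewrite mulmxA.
Qed.

Lemma curve_derivatives q c : boundary q -> smooth_curve boundary q c ->
  dotv (derive1 c 0) (grad q) = 0 /\
  qform (hess q) (derive1 c 0) + dotv (derive1n 2 c 0) (grad q) = 0.
Proof.
move=> [qV _] /smooth_curve_derive[c0 cS c2].
have tangency : \forall s \near (0 : R), dotv (derive1 c s) (grad (c s)) = 0.
  (* Every [s] near 0 has a neighbourhood on which the curve stays in the boundary; the height is
     constant there and can be differentiated at [s], not only at 0. *)
  have /near_join cS' := cS; near=> s.
  have {}cS : \forall r \near s, boundary (c r) /\ is_derive r 1 c (derive1 c r).
    by near: s.
  have [[sV _] ds] := nbhs_singleton cS.
  apply: (is_derive_unique (f := height \o c) (g := cst 0) (x := s) (v := 1)).
  - by apply: filterS cS => r [[_]].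
  - by apply: is_derive_height_comp => // i; exact: is_derive_entry.
  - exact: is_derive_cst.
have [_ dc] := nbhs_singleton cS; split.
  by have := nbhs_singleton tangency; rewrite /= c0.
apply: (is_derive_unique (f := fun s => dotv (derive1 c s) (grad (c s)))
  (g := cst 0) (x := 0) (v := 1)).
- exact: tangency.
- rewrite -c0; apply: is_derive_dotv_grad_comp => [|i|i]; first by rewrite c0.
    exact: is_derive_entry.
  exact: is_derive_entry.
Unshelve. all: by end_near. Qed.

Lemma grad_neq0 x : (0 < n)%N -> cone x -> grad x != 0.
Proof.
move=> n0 xV; case: (leqP n t) => [nt|tn].
  apply/eqP => /rowP/(_ (Ordinal n0)); have it := leq_trans n0 nt.
  rewrite !mxE /summand' it => /eqP.
  by rewrite mulf_eq0 oppr_eq0 invr_eq0 !gt_eqF ?xV ?p_gt0.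
apply/eqP => /rowP/(_ (Ordinal tn)); rewrite !mxE /summand' /= ltnn eqxx => /eqP.
by rewrite oppr_eq0 oner_eq0.
Qed.

Lemma conformal_second_fundamental_form : (0 < n)%N ->
  exists2 II, second_fundamental_form boundary domain II &
    conformal_on boundary metric II.
Proof.
move=> n0; pose N q := Num.sqrt (dotv (grad q) (grad q)).
have N0 q : boundary q -> 0 < N q.
  move=> [qV _]; rewrite sqrtr_gt0 lt0r dotv_ge0 andbT dotv_eq0.
  exact: grad_neq0.
exists (fun q => (N q)^-1 *: hess q) => [q qB|].
  have Nq := N0 _ qB; have [qV hq] := qB.
  have NN : dotv (grad q) (grad q) = N q * N q.
    by rewrite -expr2 sqr_sqrtr // dotv_ge0.
  have nuE u : dotv u (- (N q)^-1 *: grad q) = - (N q)^-1 * dotv u (grad q).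
    by rewrite dotvC dotvZl dotvC.
  (* The domain is a sublevel set of the height, so the inward unit normal is minus the normalized
     gradient. *)
  exists (- (N q)^-1 *: grad q) => [|c /(curve_derivatives qB)[_ c2]].
    split.
    - by rewrite nuE dotvZl NN; field; rewrite gt_eqF.
    - move=> _ [c /(curve_derivatives qB)[c1 _] <-].
      by rewrite nuE c1 mulr0.
    - pose nu := - (N q)^-1 *: grad q; pose l s := q + s *: nu.
      have l0 : l 0 = q by rewrite /l scale0r addr0.
      have lV : cone (l 0) by rewrite l0.
      (* Along the normal the height starts at 0 with slope [- N q], hence is negative for small
         positive parameters. *)
      have hl : is_derive (0 : R) 1 (fun s => height (l s)) (- N q).
        have := @is_derive_height_comp _ _ t p l 0 nu lV
          (fun i => is_derive_line_coord q nu 0 i).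
        rewrite l0 /nu dotvZl NN mulNr mulKf //; by rewrite gt_eqF.
      have : \forall s \near 0^'+, domain (l s).
        near=> s; split.
          near: s; apply: cvg_within; exact: (near_cone_line lV).
        have : height (l s) < height (l 0).
          near: s; apply: is_derive_lt0 hl _; by rewrite oppr_lt0.
        by rewrite l0 hq => /ltW.
      move=> [e /= e0 el]; exists e => // s /andP[s0 se].
      by apply: el => //=; rewrite sub0r normrN gtr0_norm.
  rewrite qformZ nuE; move/eqP: c2; rewrite addrC addr_eq0 => /eqP ->.
  by rewrite mulrNN.
(* Tangent vectors are orthogonal to the gradient. On them the metric reduces to the Hessian, which
   is [N q] times the second fundamental form. *)
exists N => q qB; split; first exact: N0.
move=> _ [c /(curve_derivatives qB)[c1 _] <-].
rewrite qform_cusp_metric c1 expr0n mulr0 addr0 qformZ mulVKf //.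
by rewrite gt_eqF // N0.
Unshelve. all: by end_near. Qed.

End CuspDomain.

(** * Projective maps that preserve the height are affine *)

Section HeightPreservingProjectivities.
Context {R : realType} {n : nat} (t : nat) (p : 'I_n -> R).
Hypothesis p_gt0 : forall i : 'I_n, (i < t)%N -> 0 < p i.
Hypothesis sum_p : (n <= t)%N -> \sum_i p i = 1.
Implicit Types (i : 'I_n) (x u : 'rV[R]_n).

Local Notation cone := (@positive_cone R n t).
Local Notation phi := (summand t p).
Local Notation height := (cusp_height t p).
Local Notation e_ i := (delta_mx 0 i : 'rV[R]_n).

Lemma cone_const1 : cone (const_mx 1).
Proof. by move=> i _; rewrite mxE. Qed.

Lemma cone_const1D i : cone (const_mx 1 + e_ i).
Proof. by move=> j _; rewrite !mxE ltr_pwDl ?ler0n. Qed.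

Lemma cone_addZ_delta x (k : 'I_n) (s : R) : k = t :> nat -> cone x ->
  cone (x + s *: e_ k).
Proof.
move=> kt xV i it; rewrite !mxE (_ : (i == k) = false) ?andbF ?mulr0 ?addr0 ?xV //.
by apply/negbTE; apply: contraTneq it => ->; rewrite kt ltnn.
Qed.

Lemma height_addZ_delta x (k : 'I_n) (s : R) : k = t :> nat ->
  height (x + s *: e_ k) = height x - s.
Proof.
move=> kt; rewrite /cusp_height (bigD1 k) //= [in RHS](bigD1 k) //= [RHS]addrAC.
congr (_ + _).
  by rewrite /summand kt ltnn eqxx !mxE !eqxx mulr1 opprD.
apply: eq_bigr => i ik.
by rewrite !mxE (negbTE ik) andbF mulr0 addr0.
Qed.

Lemma height_scale x (s : R) : (n <= t)%N -> cone x -> 0 < s ->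
  height (s *: x) = height x - ln s.
Proof.
move=> nt xV s0; rewrite /cusp_height -[X in _ - X]mul1r -(sum_p nt) mulr_suml.
rewrite -sumrB; apply: eq_bigr => i _.
have it : (i < t)%N by exact: leq_trans nt.
by rewrite /summand it mxE lnM ?posrE ?xV // mulrDr mulNr addrC mulNr.
Qed.

(** These are the blocks of a projective matrix, acting by [x] to [(x B + c) / (x . a + b)]. Being
    affine amounts to [a = 0]. *)
Variables (B : 'M[R]_n) (a c : 'rV[R]_n) (b : R).
Hypothesis proj_cone : forall x, cone x ->
  [/\ dotv x a + b != 0, cone ((dotv x a + b)^-1 *: (x *m B + c)) &
      height ((dotv x a + b)^-1 *: (x *m B + c)) = height x].

(** The cone contains the whole line through [x] in the direction of index [k]; if [a 0 k] were
    nonzero, the denominator would vanish somewhere on it. *)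
Lemma denominator_const_direction x (k : 'I_n) : k = t :> nat -> cone x ->
  a 0 k = 0.
Proof.
move=> kt xV; apply/eqP/negPn/negP => ak.
have [+ _ _] := proj_cone (cone_addZ_delta (- (dotv x a + b) / a 0 k) kt xV).
by rewrite dotvDl dotvZl dotv_deltal divfK // addrAC subrr eqxx.
Qed.

(* A line in the direction of the radial flow is mapped to a line along which
   the height is affine of slope -1, hence to one in the same direction, and
   with the same parametrization. *)
Lemma denominator_eq x (k : 'I_n) : k = t :> nat -> cone x ->
  dotv x a + b = B k k.
Proof.
move=> kt xV; set l := dotv x a + b; have [l0 yV hy] := proj_cone xV.
pose y := l^-1 *: (x *m B + c); pose w := l^-1 *: row k B.
have lineE s : cone (y + s *: w) /\ height (y + s *: w) = height y - s.
  have -> : y + s *: w = l^-1 *: ((x + s *: e_ k) *m B + c).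
    by rewrite mulmxDl addrAC -scalemxAl -rowE scalerDr /w !scalerA (mulrC s).
  have [_] := proj_cone (cone_addZ_delta s kt xV).
  rewrite dotvDl dotvZl dotv_deltal (denominator_const_direction kt xV).
  by rewrite mulr0 addr0 -/l height_addZ_delta // /y hy.
(* Otherwise the image line would reach a point whose entry of index [i] is 0, outside the cone. *)
have w0 i : (i < t)%N -> w 0 i = 0.
  move=> it; apply/eqP/negPn/negP => wi.
  have [/(_ i it) + _] := lineE (- y 0 i / w 0 i).
  by rewrite line_entry divfK // subrr ltxx.
(* By the previous step the logarithms are constant along the image line. [P i] and [Q i] are the
   coefficients of [s] and [s ^+ 2] in the summand of index [i]. *)
pose P i := if (i < t)%N then 0 else if i == t :> nat then - w 0 i else y 0 i * w 0 i.
pose Q i := if (i <= t)%N then 0 else 2^-1 * w 0 i ^+ 2.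
have PQ s : s * (\sum_i P i) + s ^+ 2 * (\sum_i Q i) = - s.
  apply: (addrI (height y)); rewrite -(lineE s).2 !mulr_sumr -!big_split /=.
  apply: eq_bigr => i _; rewrite /summand /P /Q line_entry.
  case: (ltngtP i t) => it; first by rewrite w0 //= !mulr0 !addr0.
    by field.
  by ring.
have Q0 : \sum_i Q i = 0.
  by have := PQ 1; have := PQ (- 1); lra.
have P1 : \sum_i P i = -1.
  by have := PQ 1; rewrite Q0; lra.
(* The sum of the [Q i] is half a sum of squares, and it is 0. *)
have Qi i : (t < i)%N -> w 0 i = 0.
  move=> ti; move/eqP: Q0; rewrite psumr_eq0 => [/allP/(_ i)|j _]; last first.
    by rewrite /Q; case: ifP => // _; rewrite mulr_ge0 ?sqr_ge0 ?invr_ge0.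
  rewrite mem_index_enum /Q leqNgt ti => /(_ isT).
  by rewrite mulf_eq0 invr_eq0 pnatr_eq0 /= sqrf_eq0 => /eqP.
have : w 0 k = 1.
  move: P1; rewrite (bigD1 k) //= big1 => [|i ik].
    by rewrite addr0 /P kt ltnn eqxx => /oppr_inj.
  rewrite /P; case: (ltngtP i t) => it //; first by rewrite Qi ?mulr0.
  by move: ik; rewrite -val_eqE /= it kt eqxx.
by rewrite !mxE => /(congr1 ( *%R l)); rewrite mulVKf // mulr1 => ->.
Qed.

(* On the ray through x the height tends to -oo, while the image of the ray is
   bounded if its denominator is not constant. *)
Lemma denominator_bounded x : (n <= t)%N -> cone x -> dotv x a = 0.
Proof.
move=> nt xV; apply/eqP/negPn/negP => xa.
(* A common bound for the image coordinates far along the ray: numerators are at most [s] times the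
   sum of norms, denominators at least half of [s] times the norm of [dotv x a]. The leading 1 makes
   [m] positive. *)
pose m := 1 + \sum_i 2 * (`|(x *m B) 0 i| + `|c 0 i|) / `|dotv x a|.
have xa0 : 0 < `|dotv x a| by rewrite normr_gt0.
have t0 i : 0 <= 2 * (`|(x *m B) 0 i| + `|c 0 i|) / `|dotv x a|.
  by rewrite divr_ge0 // mulr_ge0 // addr_ge0.
have m1 i : 2 * (`|(x *m B) 0 i| + `|c 0 i|) / `|dotv x a| <= m.
  rewrite /m (bigD1 i) //= addrCA lerDl addr_ge0 //.
  by apply: sumr_ge0 => j _; exact: t0.
have m0 : 0 < m by rewrite ltr_pwDl // sumr_ge0.
(* The first term lets [s] times a norm dominate the constant [c], the second keeps [b] from
   cancelling more than half of the denominator, the third pushes the height of [s *: x] below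
   [- ln m]. *)
pose s := 1 + 2 * `|b| / `|dotv x a| + expR (cusp_height t p x + ln m).
have bxa : 0 <= 2 * `|b| / `|dotv x a| by rewrite divr_ge0 // mulr_ge0.
have s1 : 1 <= s by rewrite /s -addrA lerDl addr_ge0 // expR_ge0.
have s0 : 0 < s by exact: lt_le_trans s1.
have sb : 2 * `|b| <= s * `|dotv x a|.
  by rewrite -ler_pdivrMr // /s addrAC lerDr addr_ge0 ?expR_ge0.
have sxV : cone (s *: x) by move=> i it; rewrite mxE mulr_gt0 ?xV.
have [d0 yV] := proj_cone sxV.
rewrite [RHS]height_scale // => hy.
have dE : s * `|dotv x a| <= 2 * `|dotv (s *: x) a + b|.
  have := ler_normB (dotv (s *: x) a + b) b.
  rewrite addrK dotvZl normrM (gtr0_norm s0); move: sb; lra.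
have ym i : ((dotv (s *: x) a + b)^-1 *: (s *: x *m B + c)) 0 i <= m.
  apply: le_trans (m1 i); apply: le_trans (ler_norm _) _.
  rewrite mxE normrM normfV mulrC ler_pdivrMr ?normr_gt0 //.
  rewrite mulrAC ler_pdivlMr //.
  have num : `|(s *: x *m B + c) 0 i| <= s * (`|(x *m B) 0 i| + `|c 0 i|).
    have -> : (s *: x *m B + c) 0 i = c 0 i + s * (x *m B) 0 i.
      by rewrite -scalemxAl addrC line_entry.
    rewrite (le_trans (ler_normD _ _)) // addrC.
    by rewrite normrM (gtr0_norm s0) mulrDr lerD2l ler_peMl.
  apply: (le_trans (ler_wpM2r (ltW xa0) num)).
  by rewrite mulrAC [leRHS]mulrAC ler_wpM2r // addr_ge0.
(* The image coordinates are at most [m] and the weights sum to 1, so the image has height at least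
   [- ln m]; this contradicts the choice of [s]. *)
have : - ln m <= height x - ln s.
  rewrite -hy -[X in - X]mul1r -(sum_p nt) mulr_suml -sumrN.
  apply: ler_sum => i _; have it : (i < t)%N by exact: leq_trans nt.
  rewrite /summand it mulNr lerN2 ler_pM2l ?p_gt0 //.
  by rewrite ler_ln ?posrE ?ym //; exact: yV.
rewrite lerBrDl -lerBrDr opprK leNgt => /negP; apply.
by rewrite -[X in X < _]expRK ltr_ln ?posrE ?expR_gt0 // /s ltr_pwDl //.
Qed.

(** On the cone [dotv x a] takes a single value, so it agrees at two points of the cone that differ
    by a basis vector, and each entry of [a] is 0. *)
Lemma denominator_const : a = 0.
Proof.
apply/rowP => i; rewrite [RHS]mxE.
have ai : a 0 i = dotv (const_mx 1 + e_ i) a - dotv (const_mx 1) a.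
  by rewrite dotvDl dotv_deltal addrC addKr.
case: (leqP n t) => [nt|tn].
  by rewrite ai !denominator_bounded ?subrr //; [exact: cone_const1|exact: cone_const1D].
pose k := Ordinal tn; have kt : k = t :> nat by [].
have E x : cone x -> dotv x a = B k k - b.
  by move=> /(denominator_eq kt) <-; rewrite addrK.
by rewrite ai !E ?subrr //; [exact: cone_const1|exact: cone_const1D].
Qed.

End HeightPreservingProjectivities.

(** * From [psi] to the separable height, and invariance under the group and the flow *)

Section GeneralizedCusps.
Context {R : realType} {n : nat}.
Implicit Types (psi : {scalar 'rV[R]_n}) (x : 'rV[R]_n).

Lemma card_ord_lt (m : nat) : (m <= n)%N -> #|[set j : 'I_n | (j < m)%N]%SET| = m.
Proof.
move=> mn; rewrite -sum1dep_card -(big_ord_widen n (fun=> 1%N) mn).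
by rewrite sum1_card card_ord.
Qed.

(** The coefficients are nonincreasing, so the positive ones form an initial segment, whose length
    is the type. *)
Lemma coef_gt0 psi (i : 'I_n) : chamber psi ->
  (0 < coef psi i) = (i < cusp_type psi)%N.
Proof.
move=> [mono _]; apply/idP/idP => [i0|].
  rewrite -[X in (X <= _)%N](card_ord_lt (ltn_ord i)); apply: subset_leq_card.
  apply/fintype.subsetP => j; rewrite !inE ltnS => /mono; exact: lt_le_trans.
apply: contraTT => i0; rewrite -leqNgt.
rewrite -[X in (_ <= X)%N](card_ord_lt (ltnW (ltn_ord i))).
apply: subset_leq_card; apply/fintype.subsetP => j; rewrite !inE; apply: contraTT.
by rewrite -leqNgt => /mono ji; apply: contra i0 => /lt_le_trans; exact.
Qed.

Definition weight psi (i : 'I_n) : R :=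
  if (cusp_type psi < n)%N then coef psi i
  else (\sum_j coef psi j)^-1 * coef psi i.

Lemma sum_coef_gt0 psi : chamber psi -> (0 < n)%N -> (n <= cusp_type psi)%N ->
  0 < \sum_j coef psi j.
Proof.
move=> psiA n0 nt; rewrite (bigD1 (Ordinal n0)) //= ltr_pwDl //.
  by rewrite coef_gt0 //; exact: leq_trans nt.
by apply: sumr_ge0 => i _; exact: psiA.2.
Qed.

Lemma weight_gt0 psi (i : 'I_n) : chamber psi -> (i < cusp_type psi)%N ->
  0 < weight psi i.
Proof.
move=> psiA it; rewrite /weight; case: (leqP n (cusp_type psi)) => nt.
  rewrite mulr_gt0 ?coef_gt0 // invr_gt0 sum_coef_gt0 //.
  exact: leq_ltn_trans (ltn_ord i).
by rewrite coef_gt0.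
Qed.

Lemma sum_weight psi : chamber psi -> (0 < n)%N -> (n <= cusp_type psi)%N ->
  \sum_i weight psi i = 1.
Proof.
move=> psiA n0 nt; rewrite /weight ltnNge nt -mulr_sumr mulVf //.
by rewrite gt_eqF // sum_coef_gt0.
Qed.

Lemma cusp_hE psi : cusp_h psi = cusp_height (cusp_type psi) (weight psi).
Proof.
apply/funext => x; rewrite /cusp_h /cusp_height /summand /weight.
case: insubP => [k kn kt|]; last first.
  rewrite -leqNgt => nt; rewrite ltnNge nt mulNr mulr_sumr -sumrN.
  apply: eq_bigr => i _; have -> : (i < cusp_type psi)%N by exact: leq_trans nt.
  by rewrite mulrA mulNr.
have -> : - x 0 k = \sum_(i < n | i == k) - x 0 i by rewrite big_pred1_eq.
rewrite kn mulr_sumr -sumrN big_mkcond [X in _ + X + _]big_mkcond /=.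
rewrite [X in _ + _ + X]big_mkcond /= -!big_split /=; apply: eq_bigr => i _.
rewrite -val_eqE /= kt; case: (ltngtP i (cusp_type psi)) => _.
- by rewrite add0r addr0 mulNr.
- by rewrite !add0r.
- by rewrite !addr0.
Qed.

(** The last homogeneous coordinate of the image of [[x : 1]] under [A]. *)
Definition denominator (A : 'M[R]_(n + 1)) x : R :=
  dotv x (ursubmx A^T)^T + drsubmx A^T 0 0.

Lemma row_mx1_mul (A : 'M[R]_(n + 1)) x : row_mx x 1%:M *m A^T =
  row_mx (x *m ulsubmx A^T + dlsubmx A^T) (denominator A x)%:M.
Proof.
rewrite -[X in _ *m X]submxK mul_row_block !mul1mx; congr row_mx.
apply/matrixP => i j; rewrite !ord1 /denominator dotvE trmxK.
by rewrite [LHS]mxE [RHS]mxE eqxx mulr1n.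
Qed.

Lemma affine_actE (A : 'M[R]_(n + 1)) x : affine_act A x =
  (denominator A x)^-1 *: (x *m ulsubmx A^T + dlsubmx A^T).
Proof. by rewrite /affine_act row_mx1_mul row_mxKl row_mxKr mxE eqxx mulr1n. Qed.

(** The line of [[x : 1]] is sent to that of [[y : 1]] for some [y] of the same level. Hence the
    last coordinate of the image is nonzero, and dividing by it gives [y]. *)
Lemma cusp_group_affine_act psi g A x : cusp_group psi g -> g A -> cusp_V psi x ->
  [/\ denominator A x != 0, cusp_V psi (affine_act A x) &
      cusp_h psi (affine_act A x) = cusp_h psi x].
Proof.
move=> [_ gG] gA xV; have xL : level psi (cusp_h psi x) x by [].
have : (proj_act A @` (@proj_pt R n @` level psi (cusp_h psi x)))
    (proj_act A (proj_pt x)).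
  by exists (proj_pt x) => //; exists x.
rewrite (gG A gA) => -[y [yV hy]].
rewrite /proj_act /proj_pt limg_line lfunE /= row_mx1_mul => yE.
have /vlineP[mu] : row_mx y 1%:M \in <[row_mx (x *m ulsubmx A^T + dlsubmx A^T)
    (denominator A x)%:M : 'rV[R]_(n + 1)]>%VS by rewrite -yE memv_line.
rewrite scale_row_mx => /eq_row_mx[yl /matrixP/(_ 0 0)].
rewrite !mxE eqxx !mulr1n => mud.
have d0 : denominator A x != 0.
  by apply: contra_eq_neq mud => ->; rewrite mulr0 oner_neq0.
rewrite affine_actE (_ : _^-1 = mu) -?yl //.
by apply: (mulIf d0); rewrite mulVf.
Qed.

Lemma cusp_group_affine psi g A : chamber psi -> (0 < n)%N ->
  cusp_group psi g -> g A ->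
  exists M : 'M[R]_n, exists b : 'rV[R]_n, affine_act A = fun x => x *m M + b.
Proof.
move=> psiA n0 gG gA; set d := drsubmx A^T 0 0.
have a0 : (ursubmx A^T)^T = 0.
  apply: (@denominator_const _ _ (cusp_type psi) (weight psi) _ _
            (ulsubmx A^T) _ (dlsubmx A^T) d).
  - by move=> i; exact: weight_gt0.
  - exact: sum_weight.
  - move=> x xV; have := cusp_group_affine_act gG gA xV.
    by rewrite affine_actE cusp_hE.
exists (d^-1 *: ulsubmx A^T), (d^-1 *: dlsubmx A^T); apply/funext => x.
rewrite affine_actE /denominator a0 dotvE trmx0 mulmx0 mxE add0r -/d.
by rewrite scalerDr scalemxAr.
Qed.

Lemma group_invariant_metric psi : chamber psi -> (0 < n)%N ->
  group_invariant psi (cusp_metric (cusp_type psi) (weight psi)).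
Proof.
move=> psiA n0 g gG A gA x [xV _].
have [M [b AE]] := cusp_group_affine psiA n0 gG gA.
rewrite AE; apply: (@pullback_metric_affine _ _ _ _ _ _ 0) => // y yV.
have [_] := cusp_group_affine_act gG gA yV.
by rewrite AE cusp_hE addr0.
Qed.

(** For every type, the flow at time [s] is an affine map that raises the height by [s]. *)
Lemma flow_invariant_metric psi : chamber psi -> (0 < n)%N ->
  flow_invariant psi (cusp_metric (cusp_type psi) (weight psi)).
Proof.
move=> psiA n0 s x [xV _] _.
case: (leqP n (cusp_type psi)) => [nt|tn].
  have -> : radial_flow psi s = fun y => y *m (expR (- s))%:M + 0.
    apply/funext => y; rewrite /radial_flow insubF ?mul_mx_scalar ?addr0 //.
    by rewrite ltnNge nt.
  apply: (@pullback_metric_affine _ _ _ _ _ _ s) => // y yV.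
  rewrite addr0 mul_mx_scalar; split.
    by move=> i it; rewrite mxE mulr_gt0 ?expR_gt0 ?yV.
  by rewrite height_scale ?expR_gt0 ?expRK ?opprK //; exact: sum_weight.
pose k := Ordinal tn; have kt : k = cusp_type psi :> nat by [].
have -> : radial_flow psi s = fun y => y *m 1%:M + (- s) *: delta_mx 0 k.
  apply/funext => y; rewrite /radial_flow insubT /= mulmx1 scaleNr.
  by congr (_ - _ *: delta_mx _ _); exact: val_inj.
apply: (@pullback_metric_affine _ _ _ _ _ _ s) => // y yV; rewrite mulmx1.
by rewrite height_addZ_delta // opprK; split => //; exact: cone_addZ_delta.
Qed.

End GeneralizedCusps.

Theorem theorem0p5 (R : realType) (n : nat) (psi : {scalar 'rV[R]_n})
    (hn : (2 <= n)%N) (hpsi : chamber psi) :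
  exists beta : 'rV[R]_n -> 'M[R]_n,
    [/\ riemannian_metric (cusp_domain psi) beta,
        group_invariant psi beta,
        flow_invariant psi beta,
        isometric (cusp_domain psi) beta half_space euclidean &
        exists2 II : 'rV[R]_n -> 'M[R]_n,
          second_fundamental_form (cusp_boundary psi) (cusp_domain psi) II &
          conformal_on (cusp_boundary psi) beta II].
Proof.
have n0 : (0 < n)%N by exact: ltnW.
have p0 (i : 'I_n) : (i < cusp_type psi)%N -> 0 < weight psi i.
  exact: weight_gt0.
have p1 := sum_weight hpsi n0.
exists (cusp_metric (cusp_type psi) (weight psi)).
rewrite /cusp_domain /cusp_boundary /level cusp_hE; split.
- exact: riemannian_cusp_metric.
- exact: group_invariant_metric.
- exact: flow_invariant_metric.
- exact: isometric_half_space.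
- exact: conformal_second_fundamental_form.
Qed.
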